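(* For every $n\in\mathbb{N}$, the coefficient of $z^n$ in $$\frac{(1-t)H(\mathbf{x};z)H(\mathbf{x};tz)}{H(\mathbf{x},\mathbf{y};tz)-tH(\mathbf{x},\mathbf{y};z)}$$ is Schur $\gamma$-positive.
   Context: $\mathbf{x}=(x_1,x_2,\dots)$ and $\mathbf{y}=(y_1,y_2,\dots)$ are two sets of indeterminates; $H(\mathbf{x};z)=\sum_{n\ge0}h_n(\mathbf{x})z^n$ is the generating function of the complete homogeneous symmetric functions and $H(\mathbf{x},\mathbf{y};z)=\sum_{n\ge0}h_n(\mathbf{x},\mathbf{y})z^n=H(\mathbf{x};z)H(\mathbf{y};z)$ is that in the variables $(x_1,x_2,\dots,y_1,y_2,\dots)$. The displayed quotient is a formal power series in $z$ whose coefficients are polynomials in $t$ over the ring of functions symmetric in $\mathbf{x}$ and in $\mathbf{y}$ separately. A polynomial in $t$ with real coefficients is $\gamma$-positive if for some $m\in\mathbb{N}$ it is a nonnegative linear combination of the polynomials $t^i(1+t)^{m-2i}$, $0\le i\le m/2$ (it then has center of symmetry $m/2$). A polynomial in $t$ whose coefficients are functions symmetric in $\mathbf{x}$ and $\mathbf{y}$ separately is Schur $\gamma$-positive if, when it is expanded in the basis $s_\lambda(\mathbf{x})s_\mu(\mathbf{y})$ of products of Schur functions, all coefficients are $\gamma$-positive polynomials in $t$ with the same center of symmetry (i.e. with a common value of $m$). *)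

(* Defs.v *)
From HB Require Import structures.
From mathcomp Require Import all_boot all_order all_algebra.
From mathcomp Require Import finmap multiset.
From mathcomp Require Import boolp classical_sets functions cardinality fsbigop.
From mathcomp Require Import reals.

Set Implicit Arguments.
Unset Strict Implicit.
Unset Printing Implicit Defensive.

Import Order.TTheory GRing.Theory Num.Theory.

Local Open Scope classical_set_scope.
Local Open Scope mset_scope.
Local Open Scope ring_scope.

(* An alias is needed because [nat -> A] already carries the pointwise product. *)
Definition fps (A : comNzRingType) : Type := nat -> A.

Section UnivariateSeries.
Context {A : comNzRingType}.
Implicit Types f g h : fps A.

HB.instance Definition _ := GRing.Zmodule.copy (fps A) (nat -> A).

Definition fps_one : fps A := fun n => (n == 0%N)%:R.
Definition fps_mul f g : fps A := fun n => \sum_(i < n.+1) f i * g (n - i)%N.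

Let trunc (n : nat) f : {poly A} := \poly_(i < n.+1) f i.

Let mul_trunc n k f g : (k <= n)%N -> fps_mul f g k = (trunc n f * trunc n g)`_k.
Proof.
move=> kn; rewrite coefM; apply: eq_bigr => i _; rewrite !coef_poly.
have ik : (i <= k)%N by rewrite -ltnS.
by rewrite !ltnS (leq_trans ik kn) (leq_trans (leq_subr _ _) kn).
Qed.

Let fps_mulC : commutative fps_mul.
Proof. by move=> f g; apply/funext => n; rewrite !(mul_trunc _ _ (leqnn n)) mulrC. Qed.

Let fps_mulA : associative fps_mul.
Proof.
move=> f g h; apply/funext => n; rewrite /fps_mul.
transitivity ((trunc n f * (trunc n g * trunc n h))`_n).
  rewrite coefM; apply: eq_bigr => i _.
  by rewrite coef_poly ltn_ord -(mul_trunc _ _ (leq_subr _ _)).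
rewrite mulrA coefM; apply: eq_bigr => i _; have ?: (i <= n)%N by rewrite -ltnS.
by rewrite coef_poly ltnS leq_subr -mul_trunc.
Qed.

Let fps_mul1 : left_id fps_one fps_mul.
Proof.
move=> f; apply/funext => n; rewrite /fps_mul big_ord_recl subn0 mul1r.
by rewrite big1 ?addr0 // => i _; rewrite mul0r.
Qed.

Let fps_mulDl : left_distributive fps_mul +%R.
Proof.
move=> f g h; apply/funext => n; rewrite /fps_mul /= -[RHS]big_split /=.
by apply: eq_bigr => i _; rewrite mulrDl.
Qed.

Let fps_one_neq0 : fps_one != 0.
Proof. by apply/eqP => /(congr1 (fun f : fps A => f 0%N)) /eqP; rewrite oner_eq0. Qed.

HB.instance Definition _ := GRing.Zmodule_isComNzRing.Build (fps A)
  fps_mulA fps_mulC fps_mul1 fps_mulDl fps_one_neq0.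

Lemma fpsM f g n : (f * g) n = \sum_(i < n.+1) f i * g (n - i)%N.
Proof. by []. Qed.

Definition fpsC (c : A) : fps A := fun n => if n is 0%N then c else 0.

(* [dilate c f] is f(cz). *)
Definition dilate (c : A) f : fps A := fun n => c ^+ n * f n.

Lemma fpsCM c f n : (fpsC c * f) n = c * f n.
Proof.
by rewrite fpsM big_ord_recl subn0 big1 ?addr0 // => i _; rewrite mul0r.
Qed.

Let inv_seq (f : fps A) := fix s n : seq A := if n is n'.+1 then
  rcons (s n') ((n' == 0%N)%:R - \sum_(i < n') (s n')`_i * f (n' - i)%N) else [::].

Let size_inv_seq f n : size (inv_seq f n) = n.
Proof. by elim: n => //= n IHn; rewrite size_rcons IHn. Qed.

Let nth_inv_seq f n i : (i < n)%N -> (inv_seq f n)`_i = (inv_seq f i.+1)`_i.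
Proof.
elim: n => // n IHn; rewrite ltnS leq_eqVlt => /predU1P[-> //|ltin].
by rewrite -IHn //= nth_rcons size_inv_seq ltin.
Qed.

Lemma fps_linv f : f 0%N = 1 -> exists g : fps A, g * f = 1.
Proof.
move=> f0; exists (fun n => (inv_seq f n.+1)`_n); apply/funext => n.
rewrite fpsM big_ord_recr /= subnn f0 mulr1 nth_rcons size_inv_seq ltnn eqxx.
rewrite (eq_bigr (fun i : 'I_n => (inv_seq f n)`_i * f (n - i)%N)) ?subrKC // => i _.
by rewrite [in RHS]nth_inv_seq.
Qed.

End UnivariateSeries.

(* Monomials in the variables indexed by [I] are the multisets {mset I}: [m i]
   is the exponent of the variable i, and `+` multiplies monomials. *)
Section Factorizations.
Context {I : choiceType}.

Let splits := fix splits (s : seq I) : seq ({mset I} * {mset I}) :=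
  if s is x :: s' then [seq (x +` p.1, p.2) | p <- splits s'] ++
                       [seq (p.1, x +` p.2) | p <- splits s']
  else [:: (mset0, mset0)].

Definition factorizations (m : {mset I}) : seq ({mset I} * {mset I}) :=
  undup (splits m).

Let mset_cons x (s : seq I) : seq_mset (x :: s) = x +` seq_mset s.
Proof. by apply/msetP => y; rewrite mset1DE !mset_seqE /= eq_sym. Qed.

Let mem_splits s (d e : {mset I}) :
  ((d, e) \in splits s) = (d `+` e == seq_mset s).
Proof.
elim: s d e => [|x s IHs] d e /=.
  rewrite inE; apply/eqP/eqP => [[-> ->]|/msetP de0].
    by apply/msetP => y; rewrite msetE2 !mset0E mset_seqE.
  have z y : (d y = 0 /\ e y = 0)%N.
    by have /eqP := de0 y; rewrite msetE2 mset_seqE addn_eq0 => /andP[/eqP ? /eqP ?].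
  by congr pair; apply/msetP => y; rewrite mset0E; have [] := z y.
rewrite mem_cat mset_cons; apply/orP/eqP => [[] /mapP[[d' e']]|deE].
- by rewrite IHs /= => /eqP <- [-> ->]; rewrite msetDA.
- by rewrite IHs /= => /eqP <- [-> ->]; rewrite msetDCA.
have [xd|xd] := boolP (x \in d).
  left; apply/mapP; exists (d `\ x, e); last by rewrite /= msetB1K.
  by rewrite IHs -[_ `+` e](msetD1K x) msetDA msetB1K // deE msetD1K.
have xe : x \in e.
  have /msetP/(_ x) := deE; rewrite msetE2 mset1DE eqxx (mset_eq0P xd) => e1.
  by rewrite in_mset -[e x]add0n e1.
right; apply/mapP; exists (d, e `\ x); last by rewrite /= msetB1K.
by rewrite IHs -[d `+` _](msetD1K x) msetDCA msetB1K // deE msetD1K.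
Qed.

Lemma mem_factorizations (m d e : {mset I}) :
  ((d, e) \in factorizations m) = (d `+` e == m).
Proof. by rewrite mem_undup mem_splits seq_mset_id. Qed.

Lemma factorizations_uniq m : uniq (factorizations m).
Proof. exact: undup_uniq. Qed.

End Factorizations.

Definition mfps (I : choiceType) (A : comNzRingType) : Type := {mset I} -> A.

Section MultivariateSeries.
Context {I : choiceType} {A : comNzRingType}.
Implicit Types (f g h : mfps I A) (m : {mset I}).

HB.instance Definition _ := GRing.Zmodule.copy (mfps I A) ({mset I} -> A).

Definition mfps_one : mfps I A := fun m => (m == mset0)%:R.
Definition mfps_mul f g : mfps I A :=
  fun m => \sum_(p <- factorizations m) f p.1 * g p.2.

Let mfps_mulC : commutative mfps_mul.
Proof.
move=> f g; apply/funext => m; rewrite /mfps_mul.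
rewrite (perm_big [seq (p.2, p.1) | p <- factorizations m]) /=.
  by rewrite big_map; apply: eq_bigr => p _; rewrite mulrC.
apply: uniq_perm; rewrite ?map_inj_uniq ?factorizations_uniq //.
  by move=> [? ?] [? ?] [-> ->].
move=> [d e]; apply/idP/mapP => [|[[e' d'] + [-> ->]]].
  by move=> dem; exists (e, d) => //; move: dem; rewrite !mem_factorizations msetDC.
by rewrite !mem_factorizations msetDC.
Qed.

Let mfps_mulA : associative mfps_mul.
Proof.
move=> f g h; apply/funext => m; rewrite /mfps_mul.
pose F (u : {mset I} * {mset I} * {mset I}) := f u.1.1 * g u.1.2 * h u.2.
transitivity (\sum_(u <- [seq (p.1, q.1, q.2) | p <- factorizations m,
                                               q <- factorizations p.2]) F u).
  rewrite big_allpairs_dep; apply: eq_bigr => p _; rewrite mulr_sumr.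
  by apply: eq_bigr => q _; rewrite mulrA.
transitivity (\sum_(u <- [seq (q.1, q.2, p.2) | p <- factorizations m,
                                               q <- factorizations p.1]) F u); last first.
  by rewrite big_allpairs_dep; apply: eq_bigr => p _; rewrite mulr_suml.
apply: perm_big; apply: uniq_perm.
- apply: allpairs_uniq_dep => [|p _|]; rewrite ?factorizations_uniq //.
  move=> [[a b] [c d]] [[a' b'] [c' d']] /allpairsPdep[[? ?] [[? ?] [+ + ]]].
  rewrite !mem_factorizations /= => /eqP ? /eqP bE [? ? ? ?]; subst.
  move=> /allpairsPdep[[? ?] [[? ?] [+ + ]]].
  rewrite !mem_factorizations /= => /eqP ? /eqP bE [? ? ? ?]; subst.
  by move=> [-> -> ->].
- apply: allpairs_uniq_dep => [|p _|]; rewrite ?factorizations_uniq //.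
  move=> [[a b] [c d]] [[a' b'] [c' d']] /allpairsPdep[[? ?] [[? ?] [+ + ]]].
  rewrite !mem_factorizations /= => /eqP ? /eqP bE [? ? ? ?]; subst.
  move=> /allpairsPdep[[? ?] [[? ?] [+ + ]]].
  rewrite !mem_factorizations /= => /eqP ? /eqP bE [? ? ? ?]; subst.
  by move=> [-> -> ->].
move=> [[a b] c]; apply/allpairsPdep/allpairsPdep => -[[d e] [[k l]]] /=;
  rewrite !mem_factorizations /= => -[/eqP <- /eqP <- [-> -> ->]].
  by exists (d `+` k, l), (d, k); rewrite !mem_factorizations /= msetDA !eqxx.
by exists (k, l `+` e), (l, e); rewrite !mem_factorizations /= msetDA !eqxx.
Qed.

Let mfps_mul1 : left_id mfps_one mfps_mul.
Proof.
move=> f; apply/funext => m; rewrite /mfps_mul.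
have m1 : (mset0, m) \in factorizations m by rewrite mem_factorizations /= mset0D.
rewrite (bigD1_seq _ m1) ?factorizations_uniq //= /mfps_one eqxx mul1r.
rewrite big_seq_cond big1 ?addr0 // => -[d e] /=; rewrite mem_factorizations /=.
have [->|_ _] := eqVneq d mset0; last by rewrite mul0r.
by rewrite mset0D => /andP[/eqP ->]; rewrite eqxx.
Qed.

Let mfps_mulDl : left_distributive mfps_mul +%R.
Proof.
move=> f g h; apply/funext => m; rewrite /mfps_mul /= -[RHS]big_split /=.
by apply: eq_bigr => i _; rewrite mulrDl.
Qed.

Let mfps_one_neq0 : mfps_one != 0.
Proof.
apply/eqP => /(congr1 (fun f : mfps I A => f mset0)) /eqP.
by rewrite /mfps_one eqxx oner_eq0.
Qed.

HB.instance Definition _ := GRing.Zmodule_isComNzRing.Build (mfps I A)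
  mfps_mulA mfps_mulC mfps_mul1 mfps_mulDl mfps_one_neq0.

Lemma mfpsM f g m : (f * g) m = \sum_(p <- factorizations m) f p.1 * g p.2.
Proof. by []. Qed.

Definition mfpsC (c : A) : mfps I A := fun m => if m == mset0 then c else 0.

(* h_n in the variables of [I] satisfying [V]: the sum of all their monomials
   of degree n. *)
Definition complete (V : pred I) (n : nat) : mfps I A :=
  fun m => ((size m == n) && all V m)%:R.

End MultivariateSeries.

Definition intpart : Type := {la : seq nat | sorted geq la && (0%N \notin la)}.

(* Tableaux are given by their list of rows (English convention). *)
Definition is_ssyt (la : seq nat) (T : seq (seq nat)) : bool :=
  [&& shape T == la, all (sorted leq) T
    & sorted (fun r1 r2 => all2 ltn (take (size r2) r1) r2) T].

(* s_la(v 0, v 1, ...): the coefficient of m is the number of semistandard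
   tableaux T of shape la such that the product of v i over the entries i of T
   is m. The sum has finite support by [finite_ssyt] below. *)
Definition schur {I : choiceType} {A : comNzRingType}
    (v : nat -> I) (la : seq nat) : mfps I A :=
  fun m => \sum_(T \in [set T | is_ssyt la T /\
                                seq_mset [seq v i | i <- flatten T] = m]) (1 : A).

Lemma finite_ssyt (I : choiceType) (v : nat -> I) (la : seq nat) (m : {mset I}) :
  injective v ->
  finite_set [set T | is_ssyt la T /\ seq_mset [seq v i | i <- flatten T] = m].
Proof.
move=> v_inj.
apply: (@sub_finite_set _ _ (reshape la @`
    (map v @^-1` [set` permutations (m : seq I)]))).
  move=> T [/and3P[/eqP <- _ _] Tm]; exists (flatten T); last exact: flattenK.
  by rewrite /= mem_permutations -Tm perm_sym perm_eq_seq_mset.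
apply/finite_image/finite_preimage; last exact: finite_seq.
by move=> s1 s2 _ _; apply: inj_map.
Qed.

(* The center of symmetry is m / 2. The zero polynomial has every center. *)
Definition gamma_positive {R : realType} (m : nat) (p : {poly R}) : Prop :=
  exists2 g : nat -> R, (forall i, 0 <= g i) &
    p = \sum_(i < m./2.+1) g i *: ('X^i * (1 + 'X) ^+ (m - i.*2)).

(* The variables are x_i, indexed by [inl i], and y_i, indexed by [inr i]. The
   functions symmetric in x and in y separately form a subring; the quotient
   below is unique in the larger ring, and a finite combination of products
   s_la(x) s_mu(y) is in the subring. *)
Notation series_xy R := (mfps (nat + nat)%type R).

(* [c (la, mu)] is the coefficient of s_la(x) s_mu(y), as a polynomial in the
   indeterminate t = ['X]. The value of [m] is common to all of them. *)
Definition schur_gamma_positive {R : realType} (f : {poly series_xy R}) : Prop :=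
  exists (m : nat) (c : {fsfun intpart * intpart -> {poly R} with 0}),
    (forall lamu, gamma_positive m (c lamu)) /\
    f = \sum_(lamu <- finsupp c)
          map_poly mfpsC (c lamu) *
          (schur inl (val lamu.1) * schur inr (val lamu.2))%:P.

(* H(V; z), for a set V of variables among the x_i and y_i *)
Definition Hseries (R : realType) (V : pred (nat + nat)) :
    fps {poly series_xy R} :=
  fun n => (complete V n)%:P.

Definition Hx (R : realType) := Hseries R is_inl.
Definition Hxy (R : realType) := Hseries R predT.

Definition numerator (R : realType) : fps {poly series_xy R} :=
  fpsC (1 - 'X) * Hx R * dilate 'X (Hx R).
Definition denominator (R : realType) : fps {poly series_xy R} :=
  dilate 'X (Hxy R) - fpsC 'X * Hxy R.

(* The constant term 1 - t of the denominator is not invertible; nevertheless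
   the quotient exists, and it is unique. *)
Lemma quotient_exists_unique (R : realType) :
  exists! Q : fps {poly series_xy R}, Q * denominator R = numerator R.
Proof.
pose D : fps {poly series_xy R} := fun n =>
  if n is k.+1 then - (\sum_(i < k) 'X^i) * 'X * Hxy R n else 1.
have H0 : Hxy R 0%N = 1.
  rewrite /Hxy /Hseries -[RHS]polyC1; congr polyC; apply/funext => m.
  rewrite /complete (eq_all (a2 := predT)) // all_predT andbT.
  rewrite [RHS]/GRing.one /= /mfps_one; congr (_%:R).
  by rewrite size_eq0; congr nat_of_bool; apply/eqP/eqP => [m0|->];
    [rewrite -[m]seq_mset_id m0; apply/msetP => y; rewrite mset_seqE mset0E
    |exact: enum_mset0].
have denE : denominator R = fpsC (1 - 'X) * D.
  apply/funext => n; rewrite fpsCM.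
  transitivity (dilate 'X (Hxy R) n - (fpsC 'X * Hxy R) n); first by [].
  rewrite fpsCM /dilate; case: n => [|n]; first by rewrite H0 !mulr1 expr0.
  rewrite -mulrBl /D !mulrA; congr (_ * _).
  rewrite mulrN -mulNr opprB -subrX1 mulrBl mul1r exprSr.
  by [].
have [E ED] : exists E, E * D = 1 by exact: fps_linv.
have reg (f g : fps {poly series_xy R}) :
    f * fpsC (1 - 'X) = g * fpsC (1 - 'X) -> f = g.
  move=> fg; apply/funext => n.
  have /(congr1 (fun h : fps _ => h n)) := fg.
  rewrite ![_ * fpsC _]mulrC !fpsCM ![(1 - 'X) * _]mulrC -opprB !mulrN.
  by move=> /oppr_inj; apply: (monic_rreg (monicXsubC 1)).
exists (E * (Hx R * dilate 'X (Hx R))); split.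
  by rewrite denE [_ * D]mulrC mulrACA ED mul1r mulrC mulrA.
move=> Q; rewrite denE /numerator => QE; apply: reg.
rewrite -[Q * _]mulr1 -ED [E * D]mulrC !mulrA -(mulrA Q) QE.
by rewrite mulrC !mulrA [RHS]mulrC !mulrA [E * _]mulrC.
Qed.

(* Main.v *)
(* Put P(f) = sum of f(w) times the monomial of w, over all words w in the
   letters x_i, y_i; P turns the concatenation product into the product of
   power series. Call two consecutive letters linked when they are x_a x_b with
   b < a, or y_a y_b with a <= b, or x_a y_b, and cut a word into its maximal
   linked runs. Let F(w) be the product over the runs of 1 + t for x, t for xx,
   t (1 + t)^(j-1) for x y^j, t (1 + t)^(j-2) for y^j with j >= 2, and 0 for any
   other run. As in Gessel's run theorem, P(F) is the inverse of
     (E(x;-z) H(y;tz) - t E(x;-tz) H(y;z)) / (1 - t),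
   and multiplying by H(x;z) H(x;tz) shows that P(F) is the quotient, the
   coefficient of z^n being the part of degree n.

   Robinson-Schensted insertion, of the x-letters into one tableau and of the
   y-letters into another, maps the words bijectively to triples formed by two
   semistandard tableaux and the word of the rows in which the shapes grow. That
   word determines which letters are linked, hence F; summing over the tableaux
   first gives sum_q F(q) s_la(x) s_mu(y), and each nonzero F(q) is of the form
   t^a (1 + t)^(n - 2a). *)

Require Import Defs.
From HB Require Import structures.
From mathcomp Require Import all_boot all_order all_algebra.
From mathcomp Require Import finmap multiset.
From mathcomp Require Import boolp classical_sets functions cardinality fsbigop.
From mathcomp Require Import reals ring zify.

Set Implicit Arguments.
Unset Strict Implicit.
Unset Printing Implicit Defensive.

Import Order.TTheory GRing.Theory Num.Theory.
Local Open Scope mset_scope.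
Local Open Scope ring_scope.

(** * Power series as sums over words *)

Section WordSeries.
Context {I : choiceType} {A : comNzRingType}.
Implicit Types (f g : seq I -> A) (w : seq I) (c : A).

Definition conv f g w : A := \sum_(i < (size w).+1) f (take i w) * g (drop i w).

(** The map P of the overview: [permutations m] lists once each word whose monomial is [m]. *)
Definition wsum f : mfps I A := fun m => \sum_(w <- permutations m) f w.

Lemma seq_mset_cat (u v : seq I) : seq_mset (u ++ v) = (seq_mset u `+` seq_mset v)%mset.
Proof. by apply/msetP => x; rewrite msetE2 !mset_seqE count_cat. Qed.

Lemma mem_permutations_mset (m : {mset I}) w :
  (w \in permutations m) = (seq_mset w == m).
Proof.
rewrite mem_permutations; apply/idP/eqP => [/eq_seq_msetP ->|<-].
  exact: seq_mset_id.
by rewrite perm_sym perm_eq_seq_mset.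
Qed.

Lemma convE f g a w :
  conv f g (a :: w) = f [::] * g (a :: w) + conv (fun u => f (a :: u)) g w.
Proof. by rewrite /conv big_ord_recl take0 drop0. Qed.

(** Cutting a word of monomial [m] in two amounts to factoring [m] and choosing a word for each
    factor. *)
Lemma wsumM f g : wsum (conv f g) = wsum f * wsum g.
Proof.
apply/funext => m; rewrite mfpsM /wsum /conv.
pose F (u : seq I * seq I) := f u.1 * g u.2.
pose s1 := [seq (take i w, drop i w) | w <- permutations m, i <- iota 0 (size w).+1].
pose t (p : {mset I} * {mset I}) :=
  [seq (u, v) | u <- permutations p.1, v <- permutations p.2].
pose s2 := [seq uv | p <- factorizations m, uv <- t p].
transitivity (\sum_(u <- s1) F u).
  rewrite big_allpairs_dep; apply: eq_bigr => w _.
  by rewrite -[X in iota 0 X]subn0 -/(index_iota 0 _) big_mkord.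
transitivity (\sum_(u <- s2) F u); last first.
  rewrite big_allpairs_dep; apply: eq_bigr => p _; rewrite big_allpairs mulr_suml.
  by apply: eq_bigr => u _; rewrite mulr_sumr.
apply/perm_big/uniq_perm.
- apply: allpairs_uniq_dep => [|w _|]; rewrite ?permutations_uniq ?iota_uniq //.
  move=> ? ? /allpairsPdep[w [i [_ + ->]]].
  rewrite mem_iota ltnS => ilt /allpairsPdep[w' [i' [_ + ->]]].
  rewrite mem_iota ltnS => ilt' /= [e1 e2].
  have e3 : i = i' by have := congr1 size e1; rewrite !size_takel.
  by subst i'; rewrite -(cat_take_drop i w) e1 e2 cat_take_drop.
- apply: allpairs_uniq_dep => [|p _|]; rewrite ?factorizations_uniq //.
    apply: allpairs_uniq; rewrite ?permutations_uniq //.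
    by move=> [? ?] [? ?] _ _ [-> ->].
  move=> ? ? /allpairsPdep[[d e] [? [_ /allpairsP[[u v] /= [+ + ->]] ->]]].
  rewrite !mem_permutations_mset => /eqP <- /eqP <-.
  move=> /allpairsPdep[[d' e'] [? [_ /allpairsP[[u' v'] /= [+ + ->]] ->]]].
  by rewrite !mem_permutations_mset => /eqP <- /eqP <- /= [-> ->].
move=> [u v]; apply/allpairsPdep/allpairsPdep => [[w [i []]]|[[d e] [[u' v'] []]]].
  rewrite mem_permutations_mset => /eqP <- _ [-> ->].
  exists (seq_mset (take i w), seq_mset (drop i w)), (take i w, drop i w); split=> //.
    by rewrite mem_factorizations -seq_mset_cat cat_take_drop.
  by apply/allpairsP; exists (take i w, drop i w); rewrite /= !mem_permutations_mset !eqxx.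
rewrite mem_factorizations => /eqP <- /allpairsP[[u1 v1] /= [+ + [-> ->]]].
rewrite !mem_permutations_mset => /eqP <- /eqP <- [-> ->].
exists (u1 ++ v1), (size u1); split; rewrite ?take_size_cat ?drop_size_cat //.
  by rewrite mem_permutations_mset seq_mset_cat.
by rewrite -[_ :: _]/(iota 0 _.+1) mem_iota size_cat /= add0n ltnS leq_addr.
Qed.

Definition wunit w : A := (w == [::])%:R.

Lemma wsum_unit : wsum wunit = 1.
Proof.
apply/funext => m; rewrite [RHS]/GRing.one /= /mfps_one /wsum.
have -> : \sum_(w <- permutations m) wunit w = ([::] \in permutations m)%:R.
  elim: (permutations m) (permutations_uniq m) => [|w s IHs] /=; first by rewrite big_nil.
  move=> /andP[ws us]; rewrite big_cons IHs // in_cons eq_sym /wunit.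
  by case: eqP ws => [->|] /=; case: (_ \in _); rewrite ?addr0 ?add0r.
rewrite mem_permutations_mset; congr (_%:R); rewrite eq_sym; congr (nat_of_bool (_ == _)).
by apply/msetP => y; rewrite mset_seqE mset0E.
Qed.

(** For [leL] the words of nonzero value are sorted and yield complete functions. For [chain] on
    x-letters they are strictly decreasing and, with scalar [- c], yield the signed elementary
    series. *)
Definition chains (V : pred I) (r : rel I) c w : A :=
  (all V w && sorted r w)%:R * c ^+ size w.

Lemma chains0 V r c : chains V r c [::] = 1.
Proof. exact: mul1r. Qed.

Lemma chains1 V r c a : chains V r c [:: a] = (V a)%:R * c.
Proof. by rewrite /chains /= !andbT. Qed.

Lemma chains_cons V r c a b w :
  chains V r c [:: a, b & w] = (V a && r a b)%:R * (c * chains V r c (b :: w)).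
Proof.
have bE : all V [:: a, b & w] && path r a (b :: w) =
    (V a && r a b) && (all V (b :: w) && path r b w).
  by rewrite /= andbACA andbA [(V a && _) && _]andbAC -!andbA.
by rewrite {1}/chains bE -mulnb natrM exprS -mulrA [_%:R * (c * _)]mulrCA.
Qed.

Lemma chains_out V r c a w : ~~ V a -> chains V r c (a :: w) = 0.
Proof. by move=> /negbTE Va; rewrite /chains /= Va mul0r. Qed.

(* [ext V r c g a w] is the part of the convolution below where the chain
   has [a] as last letter so far. *)
Fixpoint ext (V : pred I) (r : rel I) c g (a : I) w : A :=
  g w + if w is b :: w' then
    (V b && r a b)%:R * (c * ext V r c g b w') else 0.

(** Turns the sum over cut points into a recursion along the word, so that identities between
    convolutions become inductions on words. *)
Lemma conv_chains V r c g w :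
  conv (chains V r c) g w =
  g w + if w is a :: w' then (V a)%:R * (c * ext V r c g a w') else 0.
Proof.
case: w => [|a w]; first by rewrite /conv big_ord_recl big_ord0 chains0 mul1r.
rewrite convE chains0 mul1r; congr (_ + _).
elim: w a => [|b w IHw] a.
  by rewrite /conv big_ord_recl big_ord0 /= chains1 !addr0 mulrA.
rewrite convE chains1 /= !mulrDr mulrA; congr (_ + _).
transitivity ((V a && r a b)%:R * c * conv (fun u => chains V r c (b :: u)) g w).
  rewrite /conv mulr_sumr; apply: eq_bigr => i _.
  by rewrite chains_cons !mulrA.
by rewrite IHw; case: (V a); case: (V b); case: (r a b) => /=; ring.
Qed.

End WordSeries.

(** * Linked letters and the weight of a run *)

Notation letter := (nat + nat)%type.

Definition chain (u v : letter) : bool :=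
  match u, v with
  | inl a, inl b => (b < a)%N
  | inl _, inr _ => true
  | inr a, inr b => (a <= b)%N
  | inr _, inl _ => false
  end.

(** A total order with every x-letter before every y-letter; it agrees with [chain] on y-letters. *)
Definition leL (u v : letter) : bool :=
  match u, v with
  | inl a, inl b => (a <= b)%N
  | inl _, inr _ => true
  | inr a, inr b => (a <= b)%N
  | inr _, inl _ => false
  end.

(* The letters read so far in the current run: x, xx, y, or a run which may still
   be extended by y's, each with factor [s], and whose weight is already paid. *)
Variant state := X1 | X2 | Y1 | Y2.

Definition start (a : letter) := if is_inl a then X1 else Y1.

Definition advance q (a : letter) := if q is X1 then if is_inl a then X2 else Y2 else Y2.

Section Automaton.
Context {A : comNzRingType}.
Variables s p : A.

(** In the application [s] is 1 + t and [p] is t. The runs x and xx pay on stopping, and a lone y is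
    worth 0. The factor [p] of x y^j is paid at its first y, that of y^j at its second; each later y
    pays [s]. *)
Definition stop q : A := match q with X1 => s | X2 => p | Y1 => 0 | Y2 => 1 end.

Definition go q (a : letter) : A :=
  match q, is_inl a with
  | X1, true => 1 | X1, false => p | Y1, false => p | Y2, false => s | _, _ => 0
  end.

Fixpoint wt (r : rel letter) q a (w : seq letter) : A :=
  if w is b :: w' then
    if r a b then go q b * wt r (advance q b) b w' else stop q * wt r (start b) b w'
  else stop q.

Definition weight r (w : seq letter) : A := if w is a :: w' then wt r (start a) a w' else 1.

End Automaton.

(** * Multiplying the weighted words by the elementary and complete series *)

Section Inverse.
Context {A : comNzRingType}.
Variables al be : A.
Notation s := (al + be).
Notation p := (al * be).
Notation F := (weight s p chain).
Notation wt := (wt s p chain).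

(** As [be] is a root of X^2 - s X + p, a linked letter contributes [be] s - p = [be]^2, and the sum
    over cut points telescopes. *)
Lemma ext_inr a w :
  be * ext (predC is_inl) chain be F (inr a) w = be * wt Y2 (inr a) w - wt Y1 (inr a) w.
Proof.
elim: w a => [|b w IHw] a /=; first by ring.
case: b => b /=; first by ring.
case: ifP => _ /=; last by ring.
rewrite mul1r mulrDr IHw; ring.
Qed.

Definition Ysum := conv (chains (predC is_inl) chain be) F.

Lemma Ysum_inl a w : Ysum (inl a :: w) = wt X1 (inl a) w.
Proof. by rewrite /Ysum conv_chains /= mul0r addr0. Qed.

Lemma Ysum_inr a w : Ysum (inr a :: w) = be * wt Y2 (inr a) w.
Proof. rewrite /Ysum conv_chains ext_inr /=; ring. Qed.

(** The same telescoping with the root [al]: s [al] - p = [al]^2 now enters where the run stops. The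
    factor [al * al] avoids a division. *)
Lemma ext_inl a w :
  al * al * ext is_inl chain (- al) Ysum (inl a) w =
  al * wt X1 (inl a) w - wt X2 (inl a) w.
Proof.
elim: w a => [|b w IHw] a /=.
  rewrite /Ysum conv_chains /=; ring.
case: b => b /=; last by rewrite Ysum_inr; ring.
rewrite Ysum_inl; case: ifP => _ /=; last by ring.
transitivity (al * al * wt X1 (inl b) w -
  al * (al * al * ext is_inl chain (- al) Ysum (inl b) w)); first by ring.
rewrite IHw; ring.
Qed.

(** On words, this is E(x; -al z) H(y; be z) P(F). *)
Definition XYsum := conv (chains is_inl chain (- al)) Ysum.

(* The values at nonempty words are symmetric in [al] and [be], so they cancel
   when the roles of [1] and [t] are exchanged. *)
Lemma XYsumE w : al * XYsum w = match w with
  | [::] => al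
  | inl a :: w' => wt X2 (inl a) w'
  | inr a :: w' => al * be * wt Y2 (inr a) w' end.
Proof.
rewrite /XYsum conv_chains; case: w => [|[a|a] w].
- rewrite /Ysum conv_chains /=; ring.
- rewrite Ysum_inl /=.
  transitivity (al * wt X1 (inl a) w - al * al * ext is_inl chain (- al) Ysum (inl a) w).
    ring.
  rewrite ext_inl; ring.
- rewrite Ysum_inr /=; ring.
Qed.

End Inverse.

(** * The quotient as a weighted sum over words *)

Lemma leL_total : total leL.
Proof. by case=> a [] b //=; apply: leq_total. Qed.

Lemma leL_trans : transitive leL.
Proof. by case=> a [] b [] c //=; apply: leq_trans. Qed.

Lemma leL_anti : antisymmetric leL.
Proof. by case=> a [] b //= /anti_leq ->. Qed.

Section MfpsScalar.
Context {I : choiceType} {A : comNzRingType}.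
Implicit Types (f : mfps I A) (c : A).

Fact mfpsC_is_zmod_morphism : zmod_morphism (@mfpsC I A).
Proof.
move=> c d; apply/funext => m; rewrite [RHS]/GRing.add /= /GRing.opp /= /mfpsC.
by case: ifP => //; rewrite subr0.
Qed.

HB.instance Definition _ :=
  GRing.isZmodMorphism.Build A (mfps I A) mfpsC mfpsC_is_zmod_morphism.

Lemma mfpsCM c f m : (mfpsC c * f) m = c * f m.
Proof.
rewrite mfpsM.
have m1 : (mset0, m) \in factorizations m by rewrite mem_factorizations /= mset0D.
rewrite (bigD1_seq _ m1) ?factorizations_uniq //= /mfpsC eqxx.
rewrite big_seq_cond big1 ?addr0 // => -[d e] /=; rewrite mem_factorizations /=.
have [->|_ _] := eqVneq d mset0; last by rewrite mul0r.
by rewrite mset0D => /andP[/eqP ->]; rewrite eqxx.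
Qed.

Lemma wsumZ c (f : seq I -> A) : wsum (fun w => c * f w) = mfpsC c * wsum f.
Proof. by apply/funext => m; rewrite mfpsCM /wsum mulr_sumr. Qed.

Lemma wsumB (f g : seq I -> A) : wsum (fun w => f w - g w) = wsum f - wsum g.
Proof.
apply/funext => m.
by rewrite /wsum /= [RHS]/GRing.add /= /GRing.opp /= sumrB.
Qed.

End MfpsScalar.

Section Quotient.
Context {A : comNzRingType}.
Implicit Types (c : A) (V : pred letter).

Definition hsum V c : mfps letter A := fun m => (all V m)%:R * c ^+ size m.

(** Exactly one arrangement of a monomial is sorted for the total order [leL]. *)
Lemma wsum_chains V c : wsum (chains V leL c) = hsum V c.
Proof.
apply/funext => m; rewrite /wsum /hsum.
have sm : perm_eq (sort leL m) m by rewrite perm_sort.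
have sP : sort leL m \in permutations m by rewrite mem_permutations.
rewrite (bigD1_seq _ sP) ?permutations_uniq //= /chains.
rewrite (sort_sorted leL_total) andbT (perm_all _ sm) (perm_size sm).
rewrite big_seq_cond big1 ?addr0 // => w /andP[]; rewrite mem_permutations => wm.
case: (boolP (sorted leL w)) => [ws|]; last by rewrite andbF mul0r.
case/eqP; apply: (sorted_eq leL_trans leL_anti) => //.
  exact: (sort_sorted leL_total).
by rewrite perm_sym (perm_trans sm) // perm_sym.
Qed.

Lemma eq_wsum (f g : seq letter -> A) : f =1 g -> wsum f = wsum g.
Proof. by move=> /funext ->. Qed.

(** A sorted word has its x-letters first, and only the cut right after them has a nonzero value. *)
Lemma hsum_xy c : hsum is_inl c * hsum (predC is_inl) c = hsum predT c.
Proof.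
rewrite -!wsum_chains -wsumM; apply: eq_wsum => w.
have E v a : c * ext is_inl leL c (chains (predC is_inl) leL c) (inl a) v =
    chains predT leL c (inl a :: v).
  elim: v a => [|b v IHv] a; first by rewrite /= chains0 chains1 /=; ring.
  rewrite chains_cons /=; case: b => b /=.
    by rewrite IHv [chains (predC _) _ _ _]chains_out //=; ring.
  suff -> : chains predT leL c (inr b :: v) = chains (predC is_inl) leL c (inr b :: v) by ring.
  by elim: v b {IHv} => [|[d|d] v IHv] b; rewrite ?chains1 ?chains_cons //= ?mul0r ?IHv //.
rewrite conv_chains; case: w => [|[a|a] w] /=; rewrite ?E.
- by rewrite !chains0 addr0.
- by rewrite /= chains_out //; ring.
rewrite /= mul0r addr0.
by elim: w a => [|[d|d] v IHv] a; rewrite ?chains1 ?chains_cons //= ?mul0r ?IHv //.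
Qed.

Definition esum c : mfps letter A := wsum (chains is_inl chain (- c)).

(** A nonempty word that strictly decreases and then weakly increases can be cut just before or just
    after its turning letter, with opposite signs. *)
Lemma esumM c : esum c * hsum is_inl c = 1.
Proof.
rewrite /esum -wsum_chains -wsumM -wsum_unit; apply: eq_wsum => w.
have E v b : c * ext is_inl chain (- c) (chains is_inl leL c) (inl b) v =
    chains is_inl leL c (inl b :: v).
  elim: v b => [|[b|b] v IHv] a; rewrite ?chains1 ?chains_cons /= ?chains0; first by ring.
    by rewrite mulNr IHv [(a <= b)%N]leqNgt; case: (b < a)%N => /=; ring.
  by rewrite chains_out //; ring.
rewrite conv_chains; case: w => [|[a|a] w].
- by rewrite chains0 addr0.
- by rewrite mulNr E /wunit /=; ring.
- by rewrite chains_out //= /wunit /=; ring.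
Qed.

Variable t : A.
Notation F := (weight (1 + t) t chain).

Lemma wsum_weight :
  wsum F * (hsum predT t - mfpsC t * hsum predT 1) =
  mfpsC (1 - t) * hsum is_inl 1 * hsum is_inl t.
Proof.
have E : esum 1 * (hsum (predC is_inl) t * wsum F) -
    mfpsC t * (esum t * (hsum (predC is_inl) 1 * wsum F)) = mfpsC (1 - t).
  rewrite -!wsum_chains.
  pose XY a b := XYsum a b : seq letter -> A.
  (* On y-letters [chain] and [leL] agree, so H(y; bz) may be read with either relation. *)
  have XYE a b : esum a * (wsum (chains (predC is_inl) leL b) *
      wsum (weight (a + b) (a * b) chain)) = wsum (XY a b).
    rewrite -(@eq_wsum (chains (predC is_inl) chain b)) -?wsumM // => w.
    by elim: w => [|[d|d] [|[v|v] w] IHw]; rewrite ?chains0 ?chains1 ?chains_cons /= ?IHw ?mul0r //.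
  (* F depends on 1 and t only through their sum and product, so either of them may play the role of
     [al]. *)
  have F1 : F = weight (1 + t) (1 * t) chain by rewrite mul1r.
  have Ft : F = weight (t + 1) (t * 1) chain by rewrite mulr1 addrC.
  rewrite {1}F1 {1}Ft !XYE -wsumZ -wsumB.
  transitivity (mfpsC (1 - t) * wsum wunit : mfps letter A); last by rewrite wsum_unit mulr1.
  (* The prefactor [al] of [XYsumE] is 1 in the first term and t in the second. On nonempty words
     the two terms agree; the empty word leaves 1 - t. *)
  rewrite -wsumZ; apply: eq_wsum => w; rewrite -[XY 1 t w]mul1r !XYsumE.
  case: w => [|[a|a] w]; rewrite /wunit /= ?mulr1 ?mul1r ?mulr0 ?[t + 1]addrC ?subrr //.
have e1 := esumM 1; have et := esumM t.
rewrite -!hsum_xy -E.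
(* Multiplying by H(x; z) H(x; tz) pairs each [esum] with its inverse. *)
transitivity (hsum is_inl t * hsum (predC is_inl) t * wsum F * (esum 1 * hsum is_inl 1) -
  mfpsC t * (hsum is_inl 1 * hsum (predC is_inl) 1 * wsum F) * (esum t * hsum is_inl t)).
  rewrite e1 et; ring.
ring.
Qed.

End Quotient.

(** * Row insertion *)

Section RowInsertion.
Local Open Scope nat_scope.
Implicit Types (r : seq nat) (T : seq (seq nat)) (a b : nat).

Definition bump_pos r a := find (ltn a) r.
(** When no entry exceeds [a], the position is [size r] and [set_nth] appends. *)
Definition row_ins r a := set_nth 0 r (bump_pos r a) a.

(** The second component is the row in which the shape gains a box. *)
Fixpoint ins T a : seq (seq nat) * nat :=
  if T is r :: T' then
    if bump_pos r a < size r then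
      let: (T1, k) := ins T' (nth 0 r (bump_pos r a)) in (row_ins r a :: T1, k.+1)
    else (row_ins r a :: T', 0)
  else ([:: [:: a]], 0).

Definition dom r1 r2 := all2 ltn (take (size r2) r1) r2.

(** Below the last row, [head] supplies an empty row, for which [dom] is trivial. *)
Fixpoint tableau T : bool :=
  if T is r :: T' then
    [&& r != [::], sorted leq r, dom r (head [::] T') & tableau T']
  else true.

Lemma domP r1 r2 :
  reflect (size r2 <= size r1 /\ forall i, i < size r2 -> nth 0 r1 i < nth 0 r2 i)
          (dom r1 r2).
Proof.
rewrite /dom all2E size_take_min; apply: (iffP andP) => [[/eqP sz /allP al]|[sz lt]].
  have le : size r2 <= size r1 by rewrite -sz geq_minr.
  split=> // i ilt; rewrite -(nth_take 0 ilt).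
  have zlt : i < size (zip (take (size r2) r1) r2).
    by rewrite size_zip size_take_min (minn_idPl le) minnn.
  have := al _ (mem_nth (0, 0) zlt); rewrite nth_zip //=.
  by rewrite size_take_min (minn_idPl le).
have se : size (take (size r2) r1) = size r2 by rewrite size_take_min; apply/minn_idPl.
split; first by apply/eqP/minn_idPl.
apply/(all_nthP (0, 0)) => i; rewrite size_zip se minnn => ilt.
by rewrite nth_zip //= nth_take // lt.
Qed.

Lemma row_mono r i j : sorted leq r -> i <= j -> j < size r -> nth 0 r i <= nth 0 r j.
Proof.
move=> rs ij js; apply: (sorted_leq_nth leq_trans leqnn) => //.
by rewrite inE (leq_ltn_trans ij).
Qed.

Lemma row_sortedP r : reflect (forall i, i.+1 < size r -> nth 0 r i <= nth 0 r i.+1) (sorted leq r).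
Proof. exact: (sortedP 0). Qed.

Lemma bump_pos_le r a : bump_pos r a <= size r.
Proof. exact: find_size. Qed.

Lemma lt_bump_pos r a i : i < bump_pos r a -> nth 0 r i <= a.
Proof. by move=> /(before_find 0) /= /negbT; rewrite -leqNgt. Qed.

Lemma ge_bump_pos r a i :
  sorted leq r -> bump_pos r a <= i -> i < size r -> a < nth 0 r i.
Proof.
move=> rs ki isz; apply: (leq_trans _ (row_mono rs ki isz)).
by apply: (@nth_find _ 0 (ltn a)); rewrite has_find (leq_ltn_trans ki).
Qed.

Lemma bump_posE r a k : sorted leq r -> k <= size r ->
  (forall i, i < k -> nth 0 r i <= a) -> (k < size r -> a < nth 0 r k) ->
  bump_pos r a = k.
Proof.
move=> rs ksz lt ge; case: (ltngtP (bump_pos r a) k) => // [kl|].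
  by have := lt _ kl; rewrite leqNgt ge_bump_pos // (leq_trans kl).
move=> kl; have kr := leq_trans kl (bump_pos_le r a).
by have := lt_bump_pos kl; rewrite leqNgt ge.
Qed.

Lemma size_row_ins r a : size (row_ins r a) = maxn (bump_pos r a).+1 (size r).
Proof. exact: size_set_nth. Qed.

Lemma row_ins_append r a : ~~ (bump_pos r a < size r) -> row_ins r a = rcons r a.
Proof.
rewrite -leqNgt => le; have {le} : bump_pos r a = size r.
  by apply/eqP; rewrite eqn_leq bump_pos_le.
rewrite /row_ins => ->; elim: r => //= b r ->.
by [].
Qed.

Lemma size_row_bump r a : bump_pos r a < size r -> size (row_ins r a) = size r.
Proof. by rewrite size_row_ins => /maxn_idPr. Qed.

Lemma nth_row_ins r a i :
  nth 0 (row_ins r a) i = if i == bump_pos r a then a else nth 0 r i.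
Proof. by rewrite nth_set_nth. Qed.

Lemma row_ins_sorted r a : sorted leq r -> sorted leq (row_ins r a).
Proof.
move=> rs; apply/row_sortedP => i; rewrite size_row_ins leq_max !nth_row_ins ltnS => ilt.
have [ei|ni] := eqVneq i (bump_pos r a).
  rewrite ei [_.+1 == _]gtn_eqF // ltnW // ge_bump_pos // -ei.
  by case/orP: ilt => //; rewrite ei ltnn.
have [ei|ni1] := eqVneq i.+1 (bump_pos r a); first by rewrite lt_bump_pos -?ei.
by apply: row_mono => //; have := bump_pos_le r a; lia.
Qed.

Lemma row_ins_nil r a : row_ins r a != [::].
Proof. by rewrite -size_eq0 size_row_ins -lt0n leq_max. Qed.

(* The bumping path moves weakly to the left as it goes down. *)
Lemma dom_row_ins r r2 a (b := nth 0 r (bump_pos r a)) :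
  sorted leq r -> sorted leq r2 -> bump_pos r a < size r -> dom r r2 ->
  dom (row_ins r a) (row_ins r2 b).
Proof.
move=> rs r2s kr /domP[sz lt].
have k2k : bump_pos r2 b <= bump_pos r a.
  rewrite leqNgt; apply/negP => kl; have := lt_bump_pos kl.
  by rewrite leqNgt lt // (leq_trans kl) // bump_pos_le.
apply/domP; rewrite (size_row_bump kr) size_row_ins; split.
  by rewrite geq_max sz andbT (leq_ltn_trans k2k).
move=> i; rewrite !nth_row_ins leq_max; case: (eqVneq i (bump_pos r2 b)) => [-> _|ni ilt].
  case: (eqVneq (bump_pos r2 b)) => [_|ne]; first exact: ge_bump_pos.
  have kl : bump_pos r2 b < bump_pos r a by rewrite ltn_neqAle ne.
  exact: leq_ltn_trans (lt_bump_pos kl) (ge_bump_pos rs (leqnn _) kr).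
have i2 : i < size r2.
  case/orP: ilt => //; rewrite ltnS leq_eqVlt (negbTE ni) /= => /leq_trans; apply.
  exact: bump_pos_le.
case: eqVneq => [ei|_]; last exact: lt.
rewrite -ei in kr *.
by rewrite (ltn_trans _ (lt _ i2)) // ge_bump_pos // ei.
Qed.

Lemma dom_set_head r r2 a : dom r r2 -> bump_pos r a < size r = false -> dom (row_ins r a) r2.
Proof.
move=> /domP[sz lt] kr; rewrite row_ins_append ?kr //; apply/domP.
rewrite size_rcons (leqW sz); split=> // i ilt.
by rewrite nth_rcons (leq_trans ilt sz) lt.
Qed.

Lemma head_ins T a : head [::] (ins T a).1 = row_ins (head [::] T) a.
Proof. by case: T => //= r T; case: ifP => // _; case: (ins T _). Qed.

Lemma ins_tableau T a : tableau T -> tableau (ins T a).1.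
Proof.
elim: T a => //= r T IHT a /and4P[r0 rs rd tT]; case: ifP => kr.
  have := head_ins T (nth 0 r (bump_pos r a)); have := IHT (nth 0 r (bump_pos r a)) tT.
  case: (ins T _) => T1 k /= -> ->; rewrite row_ins_nil row_ins_sorted //= andbT.
  apply: dom_row_ins => //; by case: (T) tT => //= ? ? /and4P[].
by rewrite /= row_ins_nil row_ins_sorted // tT dom_set_head.
Qed.

Lemma shape_ins T a : shape (ins T a).1 = incr_nth (shape T) (ins T a).2.
Proof.
elim: T a => //= r T IHT a; case: ifP => kr.
  have := IHT (nth 0 r (bump_pos r a)); case: (ins T _) => T1 k /= ->.
  by rewrite size_row_bump.
by rewrite /= row_ins_append ?kr // size_rcons.
Qed.

Lemma perm_row_bump r a : bump_pos r a < size r ->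
  perm_eq (nth 0 r (bump_pos r a) :: row_ins r a) (a :: r).
Proof.
rewrite /row_ins; move: (bump_pos r a) => k.
elim: r k => //= b r IHr [|k] /= kr; apply/permP => P /=; first lia.
by have /permP/(_ P) /= := IHr k kr; lia.
Qed.

Lemma perm_ins T a : perm_eq (flatten (ins T a).1) (a :: flatten T).
Proof.
elim: T a => //= r T IHT a; case: ifP => kr.
  have := IHT (nth 0 r (bump_pos r a)); case: (ins T _) => T1 k /= pT.
  rewrite -(perm_cat2l (row_ins r a)) in pT; apply: (perm_trans pT).
  rewrite -cat1s catA -cat_cons perm_cat2r perm_catC.
  exact: perm_row_bump.
by rewrite /= row_ins_append ?kr // -cat_cons perm_cat2r perm_rcons.
Qed.

(** If both letters bump in the first row, the second bumped entry is smaller than the first exactly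
    when b < a, and induction applies to these entries. If one of them is appended there, the
    comparison is settled in that row. *)
Lemma ins_descent T a b : tableau T ->
  ((ins T a).2 < (ins (ins T a).1 b).2) = (b < a).
Proof.
elim: T a b => [|r T IHT] a b /=.
  by rewrite /bump_pos /=; case: (b < a).
move=> /and4P[r0 rs rd tT].
have r's := row_ins_sorted a rs.
have akE : nth 0 (row_ins r a) (bump_pos r a) = a by rewrite nth_row_ins eqxx.
have ksz : bump_pos r a < size (row_ins r a) by rewrite size_row_ins leq_max leqnn.
have appE : bump_pos (row_ins r a) b < size (row_ins r a) = false -> b < a = false.
  move=> /negbT; rewrite -leqNgt => qr; apply/negbTE; rewrite -leqNgt -akE.
  by apply: lt_bump_pos; apply: leq_trans qr.
case: ifP => kr; last first.
  rewrite /=; case: ifP => qr; last by rewrite appE.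
  case: (ins T _) => T2 k2 /=; symmetry; rewrite -akE.
  apply: (leq_trans (ge_bump_pos r's (leqnn _) qr)); apply: row_mono => //.
  by move: qr; rewrite size_row_ins; have := bump_pos_le r a; lia.
have := IHT (nth 0 r (bump_pos r a)); case: (ins T _) => T1 k1 /= IH.
case: ifP => qr; last by rewrite appE.
have := IH (nth 0 (row_ins r a) (bump_pos (row_ins r a) b)) tT.
case: (ins T1 _) => T2 k2 /=; rewrite ltnS => ->.
have q_gt := ge_bump_pos r's (leqnn _) qr; have k_gt := ge_bump_pos rs (leqnn _) kr.
(* For b < a the second bump is weakly to the left of the first, otherwise strictly to its right. *)
case: (ltnP b a) => ba.
  apply: leq_ltn_trans k_gt; rewrite -{3}akE; apply: row_mono => //.
  rewrite leqNgt; apply/negP => kq; have := lt_bump_pos kq.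
  by rewrite akE leqNgt ba.
apply/negbTE; rewrite -leqNgt; move: q_gt; rewrite nth_row_ins.
case: eqVneq => [_|ne q_gt]; first by rewrite ltnNge ba.
rewrite size_row_bump // in qr; apply: row_mono => //.
rewrite leqNgt; apply/negP => /lt_bump_pos.
by rewrite leqNgt (leq_ltn_trans ba).
Qed.

(* The bumped entry [b] recovers the position: it is the last entry of the new
   row which is smaller than [b]. *)
Lemma row_ins_inj r1 r2 a1 a2 : sorted leq r1 -> sorted leq r2 ->
  bump_pos r1 a1 < size r1 -> bump_pos r2 a2 < size r2 ->
  nth 0 r1 (bump_pos r1 a1) = nth 0 r2 (bump_pos r2 a2) ->
  row_ins r1 a1 = row_ins r2 a2 -> r1 = r2 /\ a1 = a2.
Proof.
wlog le : r1 r2 a1 a2 / bump_pos r1 a1 <= bump_pos r2 a2.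
  move=> IH; case: (leqP (bump_pos r1 a1) (bump_pos r2 a2)) => [|/ltnW] le.
    exact: IH.
  by move=> rs1 rs2 k1 k2 eb er; case: (IH r2 r1 a2 a1) => // -> ->.
move=> rs1 rs2 kr1 kr2 eb er.
have sz : size r1 = size r2 by rewrite -(size_row_bump kr1) er size_row_bump.
have nthE i : nth 0 (row_ins r1 a1) i = nth 0 (row_ins r2 a2) i by rewrite er.
have gt2 := ge_bump_pos rs2 (leqnn _) kr2.
have ek : bump_pos r1 a1 = bump_pos r2 a2.
  apply/eqP; rewrite eqn_leq le leqNgt; apply/negP => lt.
  have := nthE (bump_pos r2 a2); rewrite !nth_row_ins eqxx gtn_eqF // => e2.
  have := row_mono rs1 (ltnW lt); rewrite sz => /(_ kr2).
  by rewrite e2 eb leqNgt gt2.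
have ea : a1 = a2 by have := nthE (bump_pos r1 a1); rewrite !nth_row_ins ek eqxx.
split=> //; apply: (eq_from_nth (x0 := 0)) => // i _.
by have := nthE i; rewrite !nth_row_ins -ek; case: eqVneq => // -> _; rewrite eb ek.
Qed.

(** The row index tells whether the first row was bumped. If so, induction recovers the lower rows
    and the bumped entry, and [row_ins_inj] the first row; if not, its last entry is the inserted
    letter. *)
Lemma ins_inj T1 T2 a1 a2 : tableau T1 -> tableau T2 ->
  ins T1 a1 = ins T2 a2 -> T1 = T2 /\ a1 = a2.
Proof.
have nil_case T a c : tableau T -> ins T a = ([:: [:: c]], 0) -> T = [::] /\ a = c.
  case: T => [|r T] /= => [_ [->] //|/and4P[r0 _ _ _]]; case: ifP => kr.
    by case: (ins T _).
  case=> er; have := congr1 size er.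
  by rewrite row_ins_append ?kr // size_rcons; case: (r) r0.
elim: T1 T2 a1 a2 => [|r1 T1 IHT] [|r2 T2] a1 a2 t1 t2.
- by case=> ->.
- by move=> /esym /(nil_case _ _ _ t2)[].
- by move=> /(nil_case _ _ _ t1)[].
move: t1 t2 => /= /and4P[r10 rs1 rd1 tT1] /and4P[r20 rs2 rd2 tT2].
case: ifP => kr1; case: ifP => kr2.
- case E1: (ins T1 _) => [U1 k1]; case E2: (ins T2 _) => [U2 k2] [er eU ek].
  rewrite -eU -ek -E1 in E2; have [-> eb] := IHT _ _ _ tT1 tT2 (esym E2).
  by have [-> ->] := row_ins_inj rs1 rs2 kr1 kr2 eb er.
- by case: (ins T1 _).
- by case: (ins T2 _).
case=> er ->; move: er; rewrite !row_ins_append ?kr1 ?kr2 //.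
by move=> /rcons_inj[-> ->].
Qed.

Definition is_part (la : seq nat) : bool := sorted geq la && (0 \notin la).

Lemma is_part_behead l la : is_part (l :: la) -> is_part la.
Proof. by rewrite /is_part inE negb_or => /andP[/path_sorted -> /andP[_ ->]]. Qed.

(** Reverse bumping: [b] returns to the row above, where it replaces the last entry smaller than
    [b]. *)
Lemma row_uninsert r' r2 b : sorted leq r' -> sorted leq r2 ->
  dom r' (row_ins r2 b) -> exists r a,
  [/\ sorted leq r, size r = size r', bump_pos r a < size r, nth 0 r (bump_pos r a) = b &
      row_ins r a = r' /\ dom r r2].
Proof.
move=> rs r2s /domP[sz lt].
have k2 : bump_pos r2 b < size (row_ins r2 b) by rewrite size_row_ins leq_max leqnn.
have := lt _ k2; rewrite nth_row_ins eqxx; set k := bump_pos r2 b in k2 * => ltb.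
have kr' := leq_trans k2 sz.
(* The last position of an entry below [b]. One exists, since the entry of [r'] above the place of
   [b] is smaller than [b]. *)
pose j := (find (leq b) r').-1.
have kf : k < find (leq b) r'.
  rewrite ltnNge; apply/negP => fk; have := row_mono rs fk kr'.
  rewrite leqNgt (leq_trans ltb) //; apply: (@nth_find _ 0 (leq b)).
  by rewrite has_find (leq_ltn_trans fk).
have fsz : find (leq b) r' <= size r' := find_size (leq b) r'.
have jf : j.+1 = find (leq b) r' by rewrite /j prednK // (leq_ltn_trans _ kf).
have jr : j < size r' by rewrite jf.
have ltj i : i <= j -> nth 0 r' i < b.
  move=> ij; have /(before_find 0) /= : i < find (leq b) r' by rewrite -jf.
  by move/negbT; rewrite -ltnNge.
have gej i : j < i -> i < size r' -> b <= nth 0 r' i.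
  move=> ji ir; have fi : find (leq b) r' <= i by rewrite -jf.
  apply: leq_trans (row_mono rs fi ir); apply: (@nth_find _ 0 (leq b)).
  by rewrite has_find (leq_ltn_trans fi).
have kj : k <= j by rewrite -ltnS jf.
pose r := set_nth 0 r' j b; exists r, (nth 0 r' j).
have szr : size r = size r' by rewrite size_set_nth; apply/maxn_idPr.
have nthr i : nth 0 r i = if i == j then b else nth 0 r' i by rewrite nth_set_nth.
have rsorted : sorted leq r.
  apply/row_sortedP => i; rewrite szr !nthr => ir.
  case: (eqVneq i j) => [ei|ne]; first by rewrite ei gtn_eqF // gej // -ei.
  case: (eqVneq i.+1 j) => [e|ne1]; first by rewrite ltnW // ltj //; lia.
  exact: row_mono.
have bE : bump_pos r (nth 0 r' j) = j.
  apply: bump_posE => // [|i ij|_]; first by rewrite szr ltnW.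
    by rewrite nthr ltn_eqF // row_mono // ltnW.
  by rewrite nthr eqxx ltj.
rewrite bE szr; split=> //; first by rewrite nthr eqxx.
split.
  rewrite /row_ins bE; apply: (eq_from_nth (x0 := 0)) => [|i _].
    by rewrite size_set_nth szr; apply/maxn_idPr.
  by rewrite nth_set_nth /= nthr; case: eqVneq => [->|].
(* In column [j], which is at least [k], [b] stands over an entry of [r2] exceeding it. In column
   [k], if different, [b] separates the two entries. *)
apply/domP; rewrite szr; split; first by move: sz; rewrite size_row_ins; lia.
move=> i i2; rewrite nthr; case: (eqVneq i j) => [ei|ne].
  by apply: ge_bump_pos; rewrite // ei.
have := lt i; rewrite size_row_ins leq_max i2 orbT nth_row_ins => /(_ isT).
case: (eqVneq i) => // ek; have := ge_bump_pos r2s (leqnn _) => /(_ b).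
rewrite -ek => /(_ i2) h1 h2; exact: ltn_trans h2 h1.
Qed.

(** Reverse insertion from the box in row [k]: in row 0 its last entry is removed, and below it an
    entry is ejected upwards and reverse-bumped into the first row. *)
Lemma ins_surj T' la k : tableau T' -> is_part la -> shape T' = incr_nth la k ->
  exists T a, [/\ tableau T, shape T = la & ins T a = (T', k)].
Proof.
elim: T' la k => [|r' T' IHT] la k.
  by move=> _ _ /(congr1 size); rewrite size_incr_nth /=; case: ltnP => // /ltn_predK <-.
move=> /= /and4P[r'0 rs rd tT'] pla.
case: la k pla => [|l la] [|k] pla //=.
- case: r' r'0 rs rd => // a [|? ?] // _ _ _ []; case: (T') => // _.
  by exists [::], a.
- by case=> /eqP; rewrite size_eq0 (negbTE r'0).
- case/lastP: r' r'0 rs rd => // r a _ rs /domP[sz lt] []; rewrite size_rcons => -[rl] eT'.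
  have l0 : 0 < l by move: pla => /andP[_]; rewrite inE negb_or lt0n eq_sym => /andP[].
  have rsr : sorted leq r.
    by apply: (subseq_sorted leq_trans _ rs); rewrite -cats1 prefix_subseq.
  have ltr i : i < size r -> nth 0 r i <= a.
    move=> ir; have := @row_mono _ i (size r) rs (ltnW ir).
    by rewrite size_rcons ltnSn !nth_rcons ir ltnn eqxx => /(_ isT).
  have bE : bump_pos r a = size r by apply: bump_posE => //; rewrite ltnn.
  exists (r :: T'), a; split=> /=; last 1 first.
  + by rewrite bE ltnn row_ins_append ?bE ?ltnn.
  + apply/and4P; split=> //; first by rewrite -size_eq0 rl -lt0n.
    (* As [la] is a partition, the shortened first row still covers the second one. *)
    have szl : size (head [::] T') <= size r.
      rewrite rl; case: (T') eT' => //= r2 T2 e2; move: pla; rewrite -e2.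
      by case/andP=> /= /andP[].
    apply/domP; split=> // i ilt; have := lt i ilt.
    by rewrite nth_rcons (leq_trans ilt).
  + by rewrite rl eT'.
case=> rl eT'; have [T [b [tT sT iT]]] := IHT _ _ tT' (is_part_behead pla) eT'.
have hd : head [::] T' = row_ins (head [::] T) b by rewrite -head_ins iT.
have hs : sorted leq (head [::] T) by case: (T) tT => //= ? ? /and4P[].
rewrite hd in rd; have [r [a [rs' szr kr eb [er dr]]]] := row_uninsert rs hs rd.
exists (r :: T), a; split=> /=.
- by rewrite rs' dr tT -size_eq0 szr size_eq0 r'0.
- by rewrite szr rl sT.
by rewrite kr eb iT er.
Qed.

Lemma tableau_is_ssyt la T : is_part la -> is_ssyt la T = (shape T == la) && tableau T.
Proof.
move=> /andP[_ la0]; rewrite /is_ssyt; case: eqP => // sT; subst la.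
elim: T la0 => //= r T IHT; rewrite inE negb_or eq_sym size_eq0 => /andP[-> /IHT]/=.
case: T {IHT} => [|r2 T] /=; first by rewrite /dom /= take0 !andbT => _.
move=> <-; rewrite /dom; case: (sorted leq r) => //=.
by rewrite andbCA.
Qed.

End RowInsertion.

(** * Robinson-Schensted correspondence for words in two alphabets *)

Section RobinsonSchensted.
Local Open Scope nat_scope.
Implicit Types (P : seq (seq nat) * seq (seq nat)) (u v k : letter) (w q : seq letter)
  (sh : seq nat * seq nat).

Lemma tableau_is_part T : tableau T -> is_part (shape T).
Proof.
elim: T => // r T IHT /= /and4P[r0 rs /domP[sz _] tT].
have /andP[sT T0] := IHT tT.
rewrite /is_part inE eq_sym size_eq0 (negbTE r0) T0 andbT /=.
by case: (T) sz sT => //= r2 T2 -> ->.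
Qed.

Lemma ins_row_le T a : (ins T a).2 <= size T.
Proof.
elim: T a => //= r T IHT a; case: ifP => // _.
by have := IHT (nth 0 r (bump_pos r a)); case: (ins T _).
Qed.

(** The growing row is recorded as a [letter], tagged by the tableau that grows, so that [weight]
    also applies to recording words. *)
Definition ins2 P u :=
  match u with
  | inl a => let: (T, k) := ins P.1 a in ((T, P.2), inl k)
  | inr a => let: (T, k) := ins P.2 a in ((P.1, T), inr k)
  end : (seq (seq nat) * seq (seq nat)) * letter.

Definition tableau2 P := tableau P.1 && tableau P.2.
Definition is_part2 sh := is_part sh.1 && is_part sh.2.
Definition shape2 P := (shape P.1, shape P.2).
Definition add_box sh k :=
  match k with
  | inl i => (incr_nth sh.1 i, sh.2)
  | inr i => (sh.1, incr_nth sh.2 i)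
  end.
Definition content P : seq letter :=
  [seq inl i | i <- flatten P.1] ++ [seq inr i | i <- flatten P.2].

Lemma ins2_tableau P u : tableau2 P -> tableau2 (ins2 P u).1.
Proof.
case: P u => T1 T2 [a|a] /andP[/= t1 t2] /=.
  by have := ins_tableau a t1; case: (ins T1 a) => T k; rewrite /tableau2 /= => ->.
by have := ins_tableau a t2; case: (ins T2 a) => T k; rewrite /tableau2 /= t1 => ->.
Qed.

Lemma shape_ins2 P u : shape2 (ins2 P u).1 = add_box (shape2 P) (ins2 P u).2.
Proof.
case: P u => T1 T2 [a|a] /=; rewrite /shape2 /=.
  by have := shape_ins T1 a; case: (ins T1 a) => T k /= ->.
by have := shape_ins T2 a; case: (ins T2 a) => T k /= ->.
Qed.

Lemma perm_ins2 P u : perm_eq (content (ins2 P u).1) (u :: content P).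
Proof.
case: P u => T1 T2 [a|a]; rewrite /content /=.
  have := perm_ins T1 a; case: (ins T1 a) => T k /= /(perm_map inl) pT.
  by rewrite -cat_cons perm_cat2r.
have := perm_ins T2 a; case: (ins T2 a) => T k /= /(perm_map inr) pT.
by rewrite perm_sym -cat1s perm_catCA perm_cat2l perm_sym.
Qed.

Lemma ins2_inj P1 P2 u1 u2 : tableau2 P1 -> tableau2 P2 ->
  ins2 P1 u1 = ins2 P2 u2 -> P1 = P2 /\ u1 = u2.
Proof.
case: P1 P2 u1 u2 => T1 T2 [U1 U2] [a|a] [b|b] /andP[/= t1 t2] /andP[/= t3 t4];
  case E1: (ins _ a) => [V1 k1]; case E2: (ins _ b) => [V2 k2] // [].
  move=> e1 e2 e3; rewrite e1 e3 -E2 in E1.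
  by have [-> ->] := ins_inj t1 t3 E1; rewrite e2.
move=> e1 e2 e3; rewrite e2 e3 -E2 in E1.
by have [-> ->] := ins_inj t2 t4 E1; rewrite e1.
Qed.

Lemma ins2_surj P' sh k : tableau2 P' -> is_part2 sh -> shape2 P' = add_box sh k ->
  exists P u, [/\ tableau2 P, shape2 P = sh & ins2 P u = (P', k)].
Proof.
case: P' sh k => T1 T2 [la mu] [i|i] /andP[/= t1 t2] /andP[/= pl pm] [s1 s2].
  have [T [a [tT sT iT]]] := ins_surj t1 pl s1.
  by exists (T, T2), (inl a); rewrite /tableau2 /shape2 /= tT t2 sT iT s2.
have [T [a [tT sT iT]]] := ins_surj t2 pm s2.
by exists (T1, T), (inr a); rewrite /tableau2 /shape2 /= t1 tT sT iT s1.
Qed.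

(** The image of [chain] under recording: by [ins_descent], x_a x_b with b < a moves to a lower row,
    and y_a y_b with a <= b does not. Mixed pairs are decided by the alphabets alone. *)
Definition row_chain k1 k2 :=
  match k1, k2 with
  | inl i, inl j => i < j
  | inl _, inr _ => true
  | inr i, inr j => j <= i
  | inr _, inl _ => false
  end.

Lemma ins2_chain P u v : tableau2 P ->
  row_chain (ins2 P u).2 (ins2 (ins2 P u).1 v).2 = chain u v.
Proof.
case: P u v => T1 T2 [a|a] [b|b] /andP[/= t1 t2].
- have := ins_descent a b t1; case: (ins T1 a) => T k /=.
  by case: (ins T b) => U l /=.
- by case: (ins T1 a) => T k /=; case: (ins T2 b).
- by case: (ins T2 a) => T k /=; case: (ins T1 b).
have := ins_descent a b t2; case: (ins T2 a) => T k /=.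
by case: (ins T b) => U l /= E; rewrite leqNgt E -leqNgt.
Qed.

Lemma ins2_is_inl P u : is_inl (ins2 P u).2 = is_inl u.
Proof. by case: u => a /=; case: (ins _ a). Qed.

Definition rs_step st u :=
  let: (P, k) := ins2 st.1 u in (P, rcons st.2 k).
Definition rs w := foldl rs_step (([::], [::]), [::]) w.

Lemma rs_rcons w u :
  rs (rcons w u) = ((ins2 (rs w).1 u).1, rcons (rs w).2 (ins2 (rs w).1 u).2).
Proof. by rewrite /rs -cats1 foldl_cat /= /rs_step; case: (ins2 _ u). Qed.

Definition shape_of q := foldl add_box ([::], [::]) q.

Lemma shape_of_rcons q k : shape_of (rcons q k) = add_box (shape_of q) k.
Proof. by rewrite /shape_of -cats1 foldl_cat. Qed.

(** A new box goes to an existing row or to the one just below, hence the ranges. *)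
Definition boxes sh : seq letter :=
  [seq k <- [seq inl i | i <- iota 0 (size sh.1).+1] ++
            [seq inr i | i <- iota 0 (size sh.2).+1] | is_part2 (add_box sh k)].

(** These words encode the pairs of standard tableaux sharing the labels 1, ..., n: the i-th letter
    is the place of label i. *)
Fixpoint recordings n : seq (seq letter) :=
  if n is n'.+1 then
    [seq rcons q k | q <- recordings n', k <- boxes (shape_of q)]
  else [:: [::]].

Lemma ins2_boxes P u : tableau2 P -> (ins2 P u).2 \in boxes (shape2 P).
Proof.
move=> tP; have := ins2_tableau u tP; rewrite mem_filter -shape_ins2 => /andP[t1 t2].
rewrite /is_part2 !tableau_is_part // mem_cat.
case: u {t1 t2} => a; rewrite /ins2.
  have := ins_row_le P.1 a; case: (ins P.1 a) => T k kT.
  by apply/orP; left; apply: (@map_f _ _ inl _ k);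
  rewrite mem_iota ltnS (leq_trans kT) //= /shape size_map.
have := ins_row_le P.2 a; case: (ins P.2 a) => T k kT.
by apply/orP; right; apply: (@map_f _ _ inr _ k);
  rewrite mem_iota ltnS (leq_trans kT) //= /shape size_map.
Qed.

Lemma recordings_is_part n q : q \in recordings n -> is_part2 (shape_of q).
Proof.
case: n => [|n]; first by rewrite inE => /eqP ->.
move=> /allpairsPdep[q' [k [_ + ->]]].
by rewrite mem_filter shape_of_rcons => /andP[].
Qed.

Lemma size_recordings n q : q \in recordings n -> size q = n.
Proof.
elim: n q => [|n IHn] q; first by rewrite inE => /eqP ->.
by move=> /allpairsPdep[q' [k [/IHn <- _ ->]]]; rewrite size_rcons.
Qed.

Lemma recordings_uniq n : uniq (recordings n).
Proof.
elim: n => // n IHn; apply: allpairs_uniq_dep => //.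
  move=> q _; apply: filter_uniq; rewrite cat_uniq !map_inj_uniq ?iota_uniq.
  - by rewrite andbT; apply/hasP => -[_ /mapP[i _ ->] /mapP[]].
  - by move=> ? ? [].
  - by move=> ? ? [].
by move=> [q1 k1] [q2 k2] _ _ /= /rcons_inj[-> ->].
Qed.

Lemma rsP w : [/\ tableau2 (rs w).1, shape2 (rs w).1 = shape_of (rs w).2,
  perm_eq (content (rs w).1) w & (rs w).2 \in recordings (size w)].
Proof.
elim/last_ind: w => [|w u [tw sw pw rw]]; first by split.
have tw' := ins2_tableau u tw; have sw' := shape_ins2 (rs w).1 u.
rewrite rs_rcons size_rcons /= shape_of_rcons -sw; split=> //.
  by rewrite (perm_trans (perm_ins2 _ _)) // perm_sym perm_rcons perm_cons perm_sym.
apply/allpairsPdep; exists (rs w).2, (ins2 (rs w).1 u).2; split=> //.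
by rewrite -sw; apply: ins2_boxes.
Qed.

Lemma rs_inj : injective rs.
Proof.
elim/last_ind=> [|w u IHw] w'; case/lastP: w' => [|w' u'] //.
- by rewrite rs_rcons => /(congr1 (fun st => size st.2)) /=; rewrite size_rcons.
- by rewrite rs_rcons => /(congr1 (fun st => size st.2)) /=; rewrite size_rcons.
have [tw _ _ _] := rsP w; have [tw' _ _ _] := rsP w'.
rewrite !rs_rcons => -[eP /rcons_inj[eq ek]].
have eI : ins2 (rs w).1 u = ins2 (rs w').1 u'.
  by rewrite [LHS]surjective_pairing eP ek -surjective_pairing.
have [e ->] := ins2_inj tw tw' eI.
by rewrite (IHw w') // [LHS]surjective_pairing e eq -surjective_pairing.
Qed.

(** The insertions are undone from the last letter of [q]; at each stage the smaller shapes are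
    partitions, as reverse insertion requires. *)
Lemma rs_surj n q P : q \in recordings n -> tableau2 P -> shape2 P = shape_of q ->
  exists w, rs w = (P, q).
Proof.
elim: n q P => [|n IHn] q P.
  rewrite inE => /eqP -> _; case: P => [[|? ?] [|? ?]] // _.
  by exists [::].
move=> /allpairsPdep[q' [k [rq' _ ->]]] tP; rewrite shape_of_rcons => sP.
have [P' [u [tP' sP' iP']]] := ins2_surj tP (recordings_is_part rq') sP.
have [w rw] := IHn _ _ rq' tP' sP'.
by exists (rcons w u); rewrite rs_rcons rw /= iP'.
Qed.

Lemma rs_adjacent a w : exists k q, [/\ (rs (a :: w)).2 = k :: q, is_inl k = is_inl a,
  map is_inl q = map is_inl w & pairmap row_chain k q = pairmap chain a w].
Proof.
elim/last_ind: w => [|w v [k [q [rq ka qw pq]]]].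
  by exists (ins2 ([::], [::]) a).2, [::]; rewrite -[[:: a]]/(rcons [::] a) rs_rcons ins2_is_inl.
rewrite -rcons_cons rs_rcons rq; set k' := (ins2 _ v).2.
exists k, (rcons q k'); split=> //; first by rewrite !map_rcons qw ins2_is_inl.
rewrite -!cats1 !pairmap_cat pq /=; congr (_ ++ [:: _]).
(* The new link concerns the last two letters, which are inserted in succession into the tableaux of
   [belast a w]. *)
have [t _ _ _] := rsP (belast a w).
rewrite -(ins2_chain (last a w) v t); congr row_chain.
  by rewrite -[last k q]/(last k (k :: q)) -rq lastI rs_rcons last_rcons.
by rewrite /k' lastI rs_rcons.
Qed.

End RobinsonSchensted.

Section WeightTransfer.
Context {A : comNzRingType}.
Variables s p : A.

(** The automaton reads a letter only through its alphabet and its link to the preceding letter;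
    recording preserves both. *)
Lemma eq_wt r1 r2 st a1 a2 w1 w2 : is_inl a1 = is_inl a2 ->
  map is_inl w1 = map is_inl w2 -> pairmap r1 a1 w1 = pairmap r2 a2 w2 ->
  wt s p r1 st a1 w1 = wt s p r2 st a2 w2.
Proof.
elim: w1 w2 st a1 a2 => [|b1 w1 IHw] [|b2 w2] st a1 a2 //= ea [eb ew] [er ep].
have go_eq : go s p st b1 = go s p st b2 by rewrite /go eb.
have advance_eq : advance st b1 = advance st b2 by rewrite /advance eb.
have start_eq : start b1 = start b2 by rewrite /start eb.
by rewrite er go_eq advance_eq start_eq !(IHw w2 _ b1 b2).
Qed.

Lemma weight_rs w : weight s p chain w = weight s p row_chain (rs w).2.
Proof.
case: w => // a w; have [k [q [-> ka qw pq]]] := rs_adjacent a w.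
by rewrite /weight /start ka; apply/esym/eq_wt.
Qed.

End WeightTransfer.

(** * The Schur expansion *)

Section SchurProduct.
Context {A : comNzRingType}.
Implicit Types (m : {mset letter}) (w q : seq letter).

(** Replaces the finitely supported sum by one over a duplicate-free list, to be compared with lists
    of words. *)
Lemma schurE (I : choiceType) (v : nat -> I) la (m : {mset I}) : injective v ->
  exists s : seq (seq (seq nat)), [/\ uniq s,
    forall T, (T \in s) = is_ssyt la T && (seq_mset [seq v i | i <- flatten T] == m) &
    schur v la m = \sum_(T <- s) 1 :> A].
Proof.
move=> v_inj; have fin := finite_ssyt la m v_inj.
exists (fset_set [set T | is_ssyt la T /\ seq_mset [seq v i | i <- flatten T] = m]%classic).
split; first exact: fset_uniq.
  move=> T; rewrite in_fset_set //; apply/idP/andP => [|[tT /eqP mT]].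
    by rewrite inE /= => -[-> ->].
  by rewrite inE.
by rewrite /schur fsbig_finite.
Qed.

(** For a fixed recording word, insertion is a content-preserving bijection from words to pairs of
    semistandard tableaux of the shapes given by [q]. *)
Lemma schur_recording n q m : q \in recordings n ->
  (schur inl (shape_of q).1 * schur inr (shape_of q).2) m =
  \sum_(w <- permutations m | (rs w).2 == q) 1 :> A.
Proof.
move=> rq; have /andP[pl pm] := recordings_is_part rq.
have inl_inj : injective (inl : nat -> letter) by move=> ? ? [].
have inr_inj : injective (inr : nat -> letter) by move=> ? ? [].
have [s1 s1P] := choice (fun d => schurE (shape_of q).1 d inl_inj).
have [s2 s2P] := choice (fun d => schurE (shape_of q).2 d inr_inj).
rewrite mfpsM.
pose t (p : {mset letter} * {mset letter}) := [seq (T1, T2) | T1 <- s1 p.1, T2 <- s2 p.2].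
pose l1 := [seq P | p <- factorizations m, P <- t p].
pose l2 := [seq (rs w).1 | w <- permutations m & (rs w).2 == q].
transitivity (\sum_(P <- l1) (1 : A)).
  rewrite big_allpairs_dep; apply: eq_bigr => p _; rewrite big_allpairs.
  have [_ _ ->] := s1P p.1; have [_ _ ->] := s2P p.2; rewrite mulr_suml.
  by apply: eq_bigr => T _; rewrite mul1r.
rewrite -[RHS]big_filter; transitivity (\sum_(P <- l2) (1 : A)); last by rewrite /l2 big_map.
have contentE (T1 T2 : seq (seq nat)) : (seq_mset [seq inl i | i <- flatten T1] `+`
    seq_mset [seq inr i | i <- flatten T2] = seq_mset (content (T1, T2)))%mset.
  by rewrite /content seq_mset_cat.
apply/perm_big/uniq_perm.
- apply: allpairs_uniq_dep => [|p _|]; rewrite ?factorizations_uniq //.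
    have [u1 _ _] := s1P p.1; have [u2 _ _] := s2P p.2; apply: allpairs_uniq => //.
    by move=> [? ?] [? ?] _ _ [-> ->].
  move=> ? ? /allpairsPdep[[d e] [? [_ /allpairsP[[T1 T2] /= [+ + ->]] ->]]].
  have [_ -> _] := s1P d; have [_ -> _] := s2P e => /andP[_ /eqP <-] /andP[_ /eqP <-].
  move=> /allpairsPdep[[d' e'] [? [_ /allpairsP[[U1 U2] /= [+ + ->]] ->]]].
  have [_ -> _] := s1P d'; have [_ -> _] := s2P e' => /andP[_ /eqP <-] /andP[_ /eqP <-].
  by move=> /= [-> ->].
- rewrite map_inj_in_uniq ?filter_uniq ?permutations_uniq //.
  move=> w w'; rewrite !mem_filter => /andP[/eqP e _] /andP[/eqP e' _] eP.
  by apply: rs_inj; rewrite [LHS]surjective_pairing [RHS]surjective_pairing eP e e'.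
move=> [T1 T2]; apply/allpairsPdep/mapP => [[[d e] [? [+ /allpairsP[[U1 U2] /= [+ + ->]] [-> ->]]]]|].
  rewrite mem_factorizations => /eqP <-.
  have [_ -> _] := s1P d; have [_ -> _] := s2P e.
  move=> /andP[+ /eqP <-] /andP[+ /eqP <-]; rewrite !tableau_is_ssyt //.
  move=> /andP[/eqP sh1 t1] /andP[/eqP sh2 t2].
  have [||w rw] := @rs_surj n q (U1, U2) rq.
  + by rewrite /tableau2 /= t1.
  + by rewrite /shape2 /= sh1 sh2 -surjective_pairing.
  exists w; last by rewrite rw.
  rewrite mem_filter rw eqxx mem_permutations_mset contentE; apply/eqP/eq_seq_msetP.
  by have [_ _ + _] := rsP w; rewrite rw perm_sym.
move=> [w]; rewrite mem_filter mem_permutations_mset => /andP[/eqP rw /eqP <-] eP.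
have [] := rsP w; rewrite -eP rw => /andP[t1 t2] sh pw _.
have [sh1 sh2] : shape T1 = (shape_of q).1 /\ shape T2 = (shape_of q).2 by rewrite -sh.
exists (seq_mset [seq inl i | i <- flatten T1], seq_mset [seq inr i | i <- flatten T2]), (T1, T2).
split=> //; first by rewrite mem_factorizations /= contentE; apply/eqP/eq_seq_msetP.
apply/allpairsP; exists (T1, T2); split=> //=.
  by have [_ -> _] := s1P (seq_mset [seq inl i | i <- flatten T1]);
    rewrite tableau_is_ssyt // sh1 !eqxx t1.
by have [_ -> _] := s2P (seq_mset [seq inr i | i <- flatten T2]);
  rewrite tableau_is_ssyt // sh2 !eqxx t2.
Qed.

End SchurProduct.

(** * Comparing series in z over polynomials in t with power series whose coefficients are such
    polynomials *)

Section CoefficientExchange.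
Context {I : choiceType} {A : comNzRingType}.
Implicit Types (f g : fps {poly mfps I A}) (F G : mfps I {poly A}).

(* [f] is obtained from [F] by moving the powers of t to the outside and by
   marking the total degree with z. *)
Definition represents f F : Prop :=
  forall n m k, (f n)`_k m = (F m)`_k *+ (size m == n).

Lemma mfps_sumE (J : Type) (r : seq J) (P : pred J) (f : J -> mfps I A) m :
  (\sum_(j <- r | P j) f j) m = \sum_(j <- r | P j) f j m.
Proof. by elim/big_rec2: _ => // j x y _ <-. Qed.

Lemma represents_inj f g F : represents f F -> represents g F -> f = g.
Proof.
move=> fF gF; apply/funext => n; apply/polyP => k; apply/funext => m.
by rewrite fF gF.
Qed.

Lemma size_mset_cat (d e : {mset I}) : size (d `+` e)%mset = (size d + size e)%N.
Proof.
rewrite -size_cat; apply/perm_size/eq_seq_msetP.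
by rewrite seq_mset_cat !seq_mset_id.
Qed.

Lemma degree_split (n a b : nat) :
  (\sum_(i < n.+1) (a == i :> nat) * (b == n - i) = (a + b == n))%N.
Proof.
case: (leqP a n) => an; last first.
  rewrite big1 => [|i _]; first by rewrite gtn_eqF // ltn_addr.
  by rewrite (gtn_eqF (leq_trans (ltn_ord i) an)).
rewrite (bigD1 (inord a)) //= inordK ?ltnS // eqxx mul1n.
rewrite big1 ?addn0 => [|i]; first by congr nat_of_bool; lia.
move=> ne; case: eqP => [e1|]; last by rewrite mul0n.
by case/eqP: ne; apply/val_inj; rewrite /= inordK ?ltnS.
Qed.

(** The sizes of the two monomials force the degrees in z, so [degree_split] leaves one term of the
    Cauchy product. *)
Lemma representsM f g F G :
  represents f F -> represents g G -> represents (f * g) (F * G).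
Proof.
move=> fF gG n m k; rewrite fpsM mfpsM !coef_sum mfps_sumE.
transitivity (\sum_(i < n.+1) \sum_(p <- factorizations m) \sum_(j < k.+1)
   (F p.1)`_j *+ (size p.1 == i) * ((G p.2)`_(k - j) *+ (size p.2 == n - i)%N)).
  apply: eq_bigr => i _; rewrite coefM mfps_sumE exchange_big /=.
  by apply: eq_bigr => p _; apply: eq_bigr => j _; rewrite fF gG.
rewrite exchange_big -sumrMnl /= big_seq [RHS]big_seq; apply: eq_bigr => -[d e].
rewrite mem_factorizations /= => /eqP <-; rewrite coefM exchange_big -sumrMnl /=.
apply: eq_bigr => j _; rewrite size_mset_cat.
under eq_bigr => i _ do rewrite mulrnAl mulrnAr -mulrnA mulnC.
by rewrite sumrMnr degree_split.
Qed.

Lemma representsB f g F G :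
  represents f F -> represents g G -> represents (f - g) (F - G).
Proof.
move=> fF gG n m k.
rewrite -[(f - g) n]/(f n - g n) -[(F - G) m]/(F m - G m) !coefB mulrnBl -fF -gG.
by [].
Qed.

Lemma representsC (c : {poly mfps I A}) (c' : {poly A}) :
  (forall k m, c`_k m = c'`_k *+ (m == mset0)) -> represents (fpsC c) (mfpsC c').
Proof.
move=> cE [|n] m k; rewrite /fpsC /mfpsC.
  rewrite cE; have -> : (size m == 0)%N = (m == mset0).
    rewrite size_eq0; apply/eqP/eqP => [m0|->]; last exact: enum_mset0.
    by rewrite -[m]seq_mset_id m0; apply/msetP => y; rewrite mset_seqE mset0E.
  by case: (m == mset0); rewrite ?coef0.
rewrite coef0; case: eqP => [->|_]; last by rewrite coef0 mul0rn.
by rewrite enum_mset0.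
Qed.

Lemma represents_dilate f F :
  represents f F -> represents (dilate 'X f) (fun m => 'X ^+ size m * F m).
Proof.
move=> fF n m k; rewrite /dilate !coefXnM; case: eqP => [<-|ne].
  by case: ifP => // _; rewrite fF eqxx.
by case: ifP => _ //; rewrite fF (introF eqP ne).
Qed.

End CoefficientExchange.

(** * The quotient expanded over recording words *)

Section Main.
Variable R : realType.

Lemma mfps_natE (b : bool) (m : {mset letter}) :
  (b%:R : series_xy R) m = b%:R *+ (m == mset0).
Proof. by case: b; last by rewrite mul0rn. Qed.

Lemma representsX : represents (fpsC ('X : {poly series_xy R})) (mfpsC 'X).
Proof. by apply: representsC => k m; rewrite !coefX mfps_natE. Qed.

Lemma represents1BX : represents (fpsC (1 - 'X : {poly series_xy R})) (mfpsC (1 - 'X)).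
Proof.
apply: representsC => k m; rewrite !coefB !coef1 !coefX mulrnBl -!mfps_natE.
by [].
Qed.

Lemma represents_H V : represents (Hseries R V) (hsum V 1).
Proof.
move=> n m k; rewrite /Hseries /hsum expr1n mulr1 coefC /complete.
rewrite -polyC1 -raddfMn /= coefC; case: eqP => _; last by rewrite mul0rn.
by case: eqP => //=; rewrite ?mulr1n ?mulr0n.
Qed.

Lemma represents_HX V : represents (dilate 'X (Hseries R V)) (hsum V 'X).
Proof.
have := represents_dilate (represents_H V); congr represents; apply/funext => m.
by rewrite /hsum expr1n mulr1 mulrC.
Qed.

Notation F r := (weight (1 + 'X : {poly R}) 'X r).

Definition expansion : fps {poly series_xy R} := fun n =>
  \sum_(q <- recordings n) map_poly mfpsC (F row_chain q) *
    (schur inl (shape_of q).1 * schur inr (shape_of q).2)%:P.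

Lemma represents_expansion : represents expansion (wsum (F chain)).
Proof.
move=> n m k; rewrite /expansion coef_sum mfps_sumE /wsum coef_sum.
transitivity (\sum_(q <- recordings n) \sum_(w <- permutations m | (rs w).2 == q)
    (F row_chain q)`_k).
  rewrite big_seq [RHS]big_seq; apply: eq_bigr => q rq; rewrite coefMC.
  rewrite coef_map_id0; last by apply/funext => d; rewrite /mfpsC; case: ifP.
  by rewrite mfpsCM (schur_recording _ rq) mulr_sumr; apply: eq_bigr => w _; rewrite mulr1.
(* Each word has one recording word, of the same length; it is met in [recordings n] exactly when
   the monomial has degree [n]. *)
rewrite (exchange_big_dep xpredT) //= -sumrMnl big_seq [RHS]big_seq.
apply: eq_bigr => w; rewrite mem_permutations => /perm_size wm.
have [_ _ _ rw] := rsP w; rewrite weight_rs -wm.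
case: eqP => [e|ne].
  rewrite e in rw; rewrite big_mkcond (bigD1_seq _ rw) ?recordings_uniq //= eqxx.
  by rewrite big1 ?addr0 // => q; rewrite eq_sym => /negbTE ->.
rewrite big_seq_cond big1 // => q /andP[/size_recordings qn /eqP e].
by case: ne; rewrite -(size_recordings rw) e.
Qed.

Lemma expansionM : expansion * denominator R = numerator R.
Proof.
apply: represents_inj.
  apply: representsM represents_expansion _; apply: representsB (represents_HX _) _.
  exact: representsM representsX (represents_H _).
rewrite wsum_weight; apply: representsM _ (represents_HX _).
exact: representsM represents1BX (represents_H _).
Qed.

(** * Gamma-positivity of the coefficients *)

Definition gamma_monomial n (c : {poly R}) : Prop :=
  c = 0 \/ exists a b, n = (a.*2 + b)%N /\ c = 'X ^+ a * (1 + 'X) ^+ b.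

Lemma gamma_monomialS n c : gamma_monomial n c -> gamma_monomial n.+1 ((1 + 'X) * c).
Proof.
case=> [->|[a [b [-> ->]]]]; first by left; rewrite mulr0.
by right; exists a, b.+1; rewrite addnS exprS mulrCA.
Qed.

Lemma gamma_monomialX n c : gamma_monomial n c -> gamma_monomial n.+2 ('X * c).
Proof.
case=> [->|[a [b [-> ->]]]]; first by left; rewrite mulr0.
by right; exists a.+1, b; rewrite doubleS !addSn exprS mulrA.
Qed.

(* The number of letters of the current run which are not yet paid for. *)
Definition pending st := match st with X1 => 1 | X2 => 2 | Y1 => 1 | Y2 => 0 end%N.

(** A factor 1 + t pays for one letter and a factor t for two, so the twofold center of symmetry
    counts the letters paid for. *)
Lemma gamma_wt r st a w : gamma_monomial (size w + pending st) (wt (1 + 'X) 'X r st a w).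
Proof.
have g1 : gamma_monomial 0 1 by right; exists 0%N, 0%N; rewrite !expr0 mulr1.
have g0 n : gamma_monomial n 0 by left.
have start1 b : pending (start b) = 1%N by case: b.
have step n c : gamma_monomial n c -> forall q, gamma_monomial (n + pending q) (stop (1 + 'X) 'X q * c).
  move=> gc [] /=; rewrite ?addn0 ?addn1 ?addn2 ?mul0r ?mul1r //.
    exact: gamma_monomialS.
  exact: gamma_monomialX.
elim: w st a => [|b w IHw] st a /=; first by rewrite -[stop _ _ _]mulr1; apply: step.
case: (r a b); last by rewrite -addn1 -(start1 b); apply: step.
have := IHw (advance st b) b.
case: st; case: b => b /=; rewrite /go /= ?mul1r ?mul0r ?addn0 ?addn1 ?addn2 //.
- exact: gamma_monomialX.
- exact: gamma_monomialX.
- exact: gamma_monomialS.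
Qed.

Lemma gamma_weight r w : gamma_monomial (size w) (F r w).
Proof.
case: w => [|a w]; first by right; exists 0%N, 0%N; rewrite !expr0 mulr1.
by rewrite /= -addn1; have := gamma_wt r (start a) a w; case: a.
Qed.

Lemma gamma_positive_sum (J : Type) (r : seq J) (P : pred J) n (c : J -> {poly R}) :
  (forall j, P j -> gamma_monomial n (c j)) -> gamma_positive n (\sum_(j <- r | P j) c j).
Proof.
move=> cP; elim/big_rec: _ => [|j x Pj [g g0 ->]].
  by exists (fun=> 0) => //; rewrite big1 // => i _; rewrite scale0r.
case: (cP j Pj) => [->|[a [b [nE ->]]]]; first by rewrite add0r; exists g.
exists (fun i => (i == a)%:R + g i) => [i|]; first by rewrite addr_ge0 // ler0n.
have an : (a < n./2.+1)%N by lia.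
transitivity (\sum_(i < n./2.+1) ((i == a :> nat)%:R *: ('X^i * (1 + 'X) ^+ (n - i.*2)) : {poly R}) +
  \sum_(i < n./2.+1) g i *: ('X^i * (1 + 'X) ^+ (n - i.*2))).
  congr (_ + _); rewrite (bigD1 (Ordinal an)) //= eqxx scale1r big1 ?addr0.
    by congr (_ * _ ^+ _); lia.
  by move=> i; rewrite -val_eqE /= => /negbTE ->; rewrite scale0r.
by rewrite -big_split /=; apply: eq_bigr => i _; rewrite -scalerDl.
Qed.

(** The default is the empty partition; by [recordings_is_part] the shapes of recordings are genuine
    partitions. *)
Definition intpart_of (la : seq nat) : intpart := insubd (exist _ [::] isT : intpart) la.

Lemma val_intpart_of la : is_part la -> val (intpart_of la) = la.
Proof. exact: insubdK. Qed.

Definition recording_shape q := (intpart_of (shape_of q).1, intpart_of (shape_of q).2).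

Lemma schur_gamma_positive_expansion n : schur_gamma_positive (expansion n).
Proof.
pose S := seq_fset tt (map recording_shape (recordings n)).
(* Recording words with the same shapes are grouped; all have length [n], which provides the common
   center. *)
pose cf lamu := \sum_(q <- recordings n | recording_shape q == lamu) F row_chain q.
exists n, [fsfun lamu in S => cf lamu]; split=> [lamu|].
  rewrite fsfunE; case: ifP => _; last first.
    by exists (fun=> 0) => //; rewrite big1 // => i _; rewrite scale0r.
  rewrite /cf big_seq_cond; apply: gamma_positive_sum => q /andP[/size_recordings <- _].
  exact: gamma_weight.
(* A coefficient on [S] may vanish, so the support is first enlarged to [S]. *)
rewrite (big_fset_incl _ (B := S)) /=; first last.
- by move=> lamu lS; rewrite mem_finsupp negbK => /eqP ->; rewrite raddf0 mul0r.
- exact: finsupp_sub.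
transitivity (\sum_(lamu <- S) \sum_(q <- recordings n | recording_shape q == lamu)
   map_poly mfpsC (F row_chain q) *
    (schur inl (shape_of q).1 * schur inr (shape_of q).2)%:P : {poly series_xy R}).
  rewrite (exchange_big_dep xpredT) //= /expansion big_seq [RHS]big_seq.
  apply: eq_bigr => q rq.
  have qS : recording_shape q \in S by rewrite seq_fsetE map_f.
  rewrite big_mkcond (bigD1_seq _ qS) ?fset_uniq //= eqxx.
  by rewrite big1 ?addr0 // => lamu; rewrite eq_sym => /negbTE ->.
rewrite big_seq [RHS]big_seq; apply: eq_bigr => lamu lS.
rewrite fsfunE lS /cf raddf_sum mulr_suml big_seq_cond [RHS]big_seq_cond.
apply: eq_bigr => q /andP[rq /eqP <-]; have /andP[p1 p2] := recordings_is_part rq.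
by rewrite /= !val_intpart_of.
Qed.

End Main.

Theorem proposition6p1 (R : realType) (Q : fps {poly series_xy R})
    (hQ : Q * denominator R = numerator R) (n : nat) :
  schur_gamma_positive (Q n).
Proof.
have [Q0 [_ uniqQ]] := quotient_exists_unique R.
rewrite -(uniqQ _ hQ) (uniqQ _ (expansionM R)).
exact: schur_gamma_positive_expansion.
Qed.
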